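(* Let $p\geq 7$ be a prime number. Then there are, up to isomorphism, 7 left braces with additive group $\mathbf{Z}_p\times C_{12}$ and multiplicative group a semidirect product $\mathbf{Z}_p\rtimes D_{2\cdot 6}$. Among these, two of them are a direct product, two others have cyclic kernel of order 6 and the other three have kernel isomorphic to $D_{2\cdot 3}$.
   Context: A left brace is a set $B$ with operations $+,\cdot$ such that $(B,+)$ is an abelian group (additive group), $(B,\cdot)$ is a group (multiplicative group), and $a(b+c)=ab-a+ac$ for all $a,b,c\in B$. Isomorphisms are bijections preserving both operations. $\mathbf{Z}_m=\mathbf{Z}/m\mathbf{Z}$, $C_m$ is the cyclic group of order $m$, and $D_{2\cdot m}$ is the dihedral group of order $2m$. Given a left brace $B'$ of size 12 with multiplicative group $F$ and a group morphism $\tau:F\to\mathrm{Aut}(\mathbf{Z}_p)\simeq\mathbf{Z}_p^*$, the semidirect product of the trivial brace $\mathbf{Z}_p$ (with $a\cdot b=a+b$) and $B'$ via $\tau$ is $\mathbf{Z}_p\times B'$ with componentwise addition and $(a,b)\cdot(a',b')=(a+\tau(b)a',bb')$; it is the direct product of braces when $\tau$ is trivial. For $p\geq 7$ every left brace of size $12p$ is isomorphic to one of this form. The kernel of the brace means $\ker\tau\subseteq F$. ''Multiplicative group $\mathbf{Z}_p\rtimes F$'' means isomorphic to $\mathbf{Z}_p\rtimes_\tau F$ for some $\tau$, possibly trivial. *)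

(* Defs.v *)
From HB Require Import structures.
From mathcomp Require Import all_boot all_order all_algebra.
From mathcomp Require Import all_fingroup all_solvable.

Set Implicit Arguments.
Unset Strict Implicit.
Unset Printing Implicit Defensive.

Import GRing.Theory.
Local Open Scope ring_scope.

(* The operations of (B, +) are those of ring_scope and the operations of
   (B, .) are those of group_scope; in particular 1%g is the multiplicative
   unit, and no ring structure is involved. *)
HB.mixin Record isLeftBrace B of GRing.Zmodule B & monoid.Group B := {
  brace_mulDr : forall a b c : B,
    (a * (b + c)%R)%g = (a * b)%g - a + (a * c)%g
}.

#[short(type="leftBraceType")]
HB.structure Definition LeftBrace :=
  {B of isLeftBrace B & GRing.Zmodule B & monoid.Group B}.

#[short(type="finLeftBraceType")]
HB.structure Definition FinLeftBrace := {B of LeftBrace B & Finite B}.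

Definition brace_isog (B C : leftBraceType) : Prop :=
  exists f : B -> C, [/\ bijective f,
    {morph f : x y / x + y} & {morph f : x y / (x * y)%g}].

(* For p prime, {unit 'F_p} is Aut(Z_p), an automorphism being identified with
   the unit it multiplies by. The parameter tau is not used in the carrier: it
   selects the multiplicative structure declared below. *)
Definition sdbrace (p : nat) (B : finLeftBraceType)
  (tau : {morphism [set: B] >-> {unit 'F_p}}) : Type := ('F_p * B)%type.

Section SemidirectBrace.

Variables (p : nat) (B : finLeftBraceType).
Variable tau : {morphism [set: B] >-> {unit 'F_p}}.

Local Notation sdB := (sdbrace tau).

HB.instance Definition _ := Finite.copy sdB ('F_p * B)%type.
HB.instance Definition _ := GRing.Zmodule.copy sdB ('F_p * B)%type.

Definition sdbrace_one : sdB := (0, 1%g).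
Definition sdbrace_mul (x y : sdB) : sdB :=
  (x.1 + val (tau x.2) * y.1, (x.2 * y.2)%g).
Definition sdbrace_inv (x : sdB) : sdB :=
  (- (val (tau x.2^-1%g) * x.1), x.2^-1%g).

Fact sdbrace_mulA : associative sdbrace_mul.
Proof.
move=> x y z; congr pair => /=; last by rewrite mulgA.
by rewrite morphM ?inE //= mulrDr addrA mulrA.
Qed.

Fact sdbrace_mul1 : left_id sdbrace_one sdbrace_mul.
Proof.
by case=> a b; congr pair => /=; rewrite ?mul1g // morph1 /= mul1r add0r.
Qed.

Fact sdbrace_mulV : left_inverse sdbrace_one sdbrace_inv sdbrace_mul.
Proof. by move=> x; congr pair => /=; rewrite ?mulVg // addNr. Qed.

HB.instance Definition _ :=
  Finite_isGroup.Build sdB sdbrace_mulA sdbrace_mul1 sdbrace_mulV.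

Fact sdbrace_mulDr (x y z : sdB) :
  (x * (y + z)%R)%g = (x * y)%g - x + (x * z)%g.
Proof.
congr pair => /=; last exact: brace_mulDr.
by rewrite mulrDr addrCA; congr (_ + _); rewrite addrAC subrr add0r.
Qed.

HB.instance Definition _ := isLeftBrace.Build sdB sdbrace_mulDr.

End SemidirectBrace.

Definition additive_group_ZpxC12 (p : nat) (B : finLeftBraceType) : Prop :=
  exists f : B -> ('F_p * 'Z_12)%type,
    bijective f /\ {morph f : x y / x + y}.

(* ('U \o tau) is the action of 'D_12 on the additive group of 'F_p through
   tau; the dihedral group of order m is written 'D_m, so that D_{2.6} is
   'D_12 and D_{2.3} is 'D_6. *)
Definition mult_group_ZpD12 (p : nat) (B : finLeftBraceType) : Prop :=
  exists tau : {morphism [set: 'D_12] >-> {unit 'F_p}},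
    ([set: B] \isog [set: sdprod_by ('U \o tau)%gact])%g.

(* The kernel of a brace B isomorphic to sdbrace tau is 'ker tau. For a prime
   p >= 7 the additive Sylow p-subgroup and its complement determine (B', tau)
   up to isomorphism, so the choice of (B', tau) below does not matter.
   sdbrace tau is the direct product of the braces Z_p and B' exactly when tau
   is trivial. *)
Definition is_direct_product (p : nat) (B : finLeftBraceType) : Prop :=
  exists (B' : finLeftBraceType) (tau : {morphism [set: B'] >-> {unit 'F_p}}),
    [/\ #|B'| = 12%N, forall b, tau b = 1%g & brace_isog B (sdbrace tau)].

Definition has_cyclic6_kernel (p : nat) (B : finLeftBraceType) : Prop :=
  exists (B' : finLeftBraceType) (tau : {morphism [set: B'] >-> {unit 'F_p}}),
    [/\ #|B'| = 12%N, brace_isog B (sdbrace tau),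
        cyclic ('ker tau)%g & #|('ker tau)%g| = 6%N].

Definition has_dihedral6_kernel (p : nat) (B : finLeftBraceType) : Prop :=
  exists (B' : finLeftBraceType) (tau : {morphism [set: B'] >-> {unit 'F_p}}),
    [/\ #|B'| = 12%N, brace_isog B (sdbrace tau) & ('ker tau \isog 'D_6)%g].

(* Main.v *)
Require Import Defs.
From HB Require Import structures.
From mathcomp Require Import all_boot all_order all_algebra.
From mathcomp Require Import all_fingroup all_solvable.

(** Since p, 3 and 4 are pairwise coprime, the additive group of a brace B as
in the theorem is Z_p x Z_3 x Z_4, and each map y |-> x y - x, being an additive
automorphism, is diagonal: it multiplies the three coordinates by u(x), v(x) and
w(x). As x |-> (y |-> x y - x) is a group morphism, u, v and w are morphisms
from the multiplicative group G of B to the units of Z_p, Z_3 and Z_4. Three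
properties of G, which it inherits from its dihedral quotient of order 12 with
kernel of order p, then determine B:

- a morphism from G to the units of Z_p has values +1 and -1
  ([char_dihedral_quotient]); v and w also have square 1, since each unit of
  Z_3 and of Z_4 is its own inverse. So u, v and w are trivial on the elements
  with zero Z_4-coordinate, which form a multiplicative group of odd order 3 p,
  and therefore depend on the Z_4-coordinate only;
- G has no element of order 4 ([exp4_dihedral_quotient]). Hence x^2 = 1 for x in
  the subgroup {0} x {0} x Z_4, which forces w(c) = (-1)^c. Thus Z_4 becomes a
  fixed brace with product c + (-1)^c d, whose multiplicative group is the Klein
  group, and v, u are sign characters chi, psi of this Klein group;
- G has no central element of order 3 ([central_dihedral_quotient]), so chi is
  nontrivial.

Consequently ([brace_classification]) B is the brace [brace12p p chi psi] on
Z_p x Z_3 x Z_4 with product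
  (a, b, c) (a', b', c') = (a + psi(c) a', b + chi(c) b', c + (-1)^c c').
Conversely, each pair with chi nontrivial gives such a brace
([brace12_dihedral]). An isomorphism of semidirect products restricts to an
isomorphism of the complements compatible with the actions ([sdbrace_isog]);
applied at p and at 3, it shows that two such braces are isomorphic exactly when
their pairs (chi, psi) agree up to the automorphism c |-> - c of Z_4, which
exchanges the values of characters at 1 and 3. Of the 3 * 4 pairs this leaves 7
classes, listed in [params].

The kernel is Z_3 x ker psi. It is everything if psi is trivial. If psi = chi it
centralises Z_3 and is cyclic of order 6, and if psi is neither trivial nor chi,
some element of ker psi inverts Z_3 and the kernel is dihedral of order 6. *)

Set Implicit Arguments.
Unset Strict Implicit.
Unset Printing Implicit Defensive.

Import GRing.Theory.
Local Open Scope ring_scope.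

(** * Additive maps and torsion *)

Lemma morph_add0 (U V : zmodType) (f : U -> V) :
  {morph f : x y / x + y} -> f 0 = 0.
Proof. by move=> fD; apply: (addrI (f 0)); rewrite -fD !addr0. Qed.

Lemma morph_muln (U V : zmodType) (f : U -> V) n :
  {morph f : x y / x + y} -> {morph f : x / x *+ n}.
Proof.
move=> fD x; elim: n => [|n IHn]; first by rewrite !mulr0n (morph_add0 fD).
by rewrite !mulrS fD IHn.
Qed.

Lemma coprime_torsion (V : zmodType) (m n : nat) (x : V) :
  (0 < m)%N -> coprime m n -> x *+ m = 0 -> x *+ n = 0 -> x = 0.
Proof.
move=> m_gt0 /eqP co_mn xm xn.
have [km kn def_km _] := egcdnP n m_gt0.
have := congr1 (fun k => x *+ k) def_km.
by rewrite /= co_mn mulrnDr (mulnC km) (mulnC kn) !mulrnA xm xn !mul0rn add0r.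
Qed.

Lemma coprime_additive0 (U V : zmodType) (m n : nat) (g : U -> V) :
    (0 < m)%N -> coprime m n -> (forall u : U, u *+ m = 0) ->
    (forall v : V, v *+ n = 0) -> {morph g : x y / x + y} ->
  forall u, g u = 0.
Proof.
move=> m_gt0 co_mn Um Vn gD u; apply: (coprime_torsion m_gt0 co_mn) => //.
by rewrite -(morph_muln m gD) Um (morph_add0 gD).
Qed.

(** Coprime exponents kill the off-diagonal components of an additive map. *)
Lemma coprime_additive_diag (U V U' V' : zmodType) (m n : nat)
    (f : U * V -> U' * V') :
    (0 < m)%N -> (0 < n)%N -> coprime m n ->
    (forall x : U, x *+ m = 0) -> (forall x : U', x *+ m = 0) ->
    (forall y : V, y *+ n = 0) -> (forall y : V', y *+ n = 0) ->
    {morph f : x y / x + y} ->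
  forall x y, f (x, y) = ((f (x, 0)).1, (f (0, y)).2).
Proof.
move=> m_gt0 n_gt0 co_mn Um U'm Vn V'n fD x y.
have ->: (x, y) = (x, 0) + (0, y) by congr (_, _); rewrite /= ?addr0 ?add0r.
have fx2: (f (x, 0)).2 = 0.
  apply: (@coprime_additive0 U V' m n (fun a => (f (a, 0)).2)) => // a b.
  by rewrite -[RHS]/(_ + _).2 -fD; congr (f (_, _)).2; rewrite addr0.
have fy1: (f (0, y)).1 = 0.
  have co_nm: coprime n m by rewrite coprime_sym.
  apply: (@coprime_additive0 V U' n m (fun b => (f (0, b)).1)) => // a b.
  by rewrite -[RHS]/(_ + _).1 -fD; congr (f (_, _)).1; rewrite addr0.
rewrite fD [LHS]surjective_pairing; congr (_, _) => /=.
  by rewrite fy1 addr0.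
by rewrite fx2 add0r.
Qed.

Lemma additive_ZpE n (f : 'Z_n -> 'Z_n) :
  {morph f : x y / x + y} -> forall a, f a = f 1 * a.
Proof.
move=> fD a.
by rewrite -[in LHS](natr_Zp a) (morph_muln _ fD) -mulr_natr natr_Zp.
Qed.

(** Translation by x permutes V, so adding #|V| copies of x does not change
the sum of all elements. *)
Lemma mulrn_card (V : finZmodType) (x : V) : x *+ #|V| = 0.
Proof.
apply: (addIr (\sum_(y : V) y)); rewrite add0r [RHS](reindex_inj (addrI x)) /=.
by rewrite big_split /= sumr_const.
Qed.

Lemma mulrn_Fp p (a : 'F_p) : prime p -> a *+ p = 0.
Proof.
move=> p_pr; have /andP[_ /eqP p0] := pchar_Fp p_pr.
by rewrite -mulr_natr p0 mulr0.
Qed.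

Lemma exp_Fp p (a : 'F_p) : prime p -> a ^+ p = a.
Proof.
move=> p_pr; have chp := pchar_Fp p_pr.
by rewrite -(pFrobenius_autE chp) -(natr_Zp a) pFrobenius_aut_nat.
Qed.

(** Case analysis on ring expressions, so that each case can be computed. *)
Lemma Z4_ind (P : 'Z_4 -> Prop) :
  P 0 -> P 1 -> P (1 *+ 2) -> P (1 *+ 3) -> forall c, P c.
Proof.
move=> P0 P1 P2 P3 [[|[|[|[|//]]]] lt_c].
- by rewrite (_ : Ordinal _ = 0) //; apply: val_inj.
- by rewrite (_ : Ordinal _ = 1) //; apply: val_inj.
- by rewrite (_ : Ordinal _ = 1 *+ 2) //; apply: val_inj.
- by rewrite (_ : Ordinal _ = 1 *+ 3) //; apply: val_inj.
Qed.

Lemma F3_sqr (a b : 'F_3) : a * b = 1 -> a ^+ 2 = 1.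
Proof.
by case: a b => [[|[|[|//]]] ?] [[|[|[|//]]] ?] /eqP // _; apply/eqP.
Qed.

Lemma Z4_sqr (a b : 'Z_4) : a * b = 1 -> a ^+ 2 = 1.
Proof. by elim/Z4_ind: a; elim/Z4_ind: b => /eqP // _; apply/eqP. Qed.

Lemma odd_exp_sqr1 (R : pzRingType) (a : R) n :
  odd n -> a ^+ 2 = 1 -> a ^+ n = a.
Proof.
move=> n_odd a2; rewrite -(odd_double_half n) n_odd exprD.
by rewrite -(mul2n n./2) exprM a2 expr1n mulr1.
Qed.

Lemma coprime12_odd p : coprime p 12 -> odd p.
Proof.
by rewrite (@coprimeMr p 4 3) (@coprime_pexpr 2 p 2) // coprimen2 => /andP[].
Qed.

Lemma coprime_p12 p : prime p -> (7 <= p)%N -> coprime p 12.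
Proof.
move=> p_pr p_ge7; rewrite (@coprimeMr p 4 3) (@coprime_pexpr 2 p 2) //.
by rewrite !prime_coprime // !gtnNdvd // (leq_trans _ p_ge7).
Qed.

(** * Left braces and their semidirect products *)

Section LeftBrace.
Variable B : leftBraceType.
Implicit Types x y z : B.

Lemma brace_mulg0 x : (x * 0%R)%g = x.
Proof.
apply/eqP; rewrite -subr_eq0; apply/eqP; apply: (addIr (x * 0%R)%g).
by rewrite add0r -brace_mulDr addr0.
Qed.

Lemma brace_one : (1%g : B) = 0.
Proof. by rewrite -[RHS]mul1g brace_mulg0. Qed.

(** The lambda map of the brace: x |-> lambda x is a morphism from the
multiplicative group to the automorphisms of the additive group. *)
Definition lambda x y : B := (x * y)%g - x.

Lemma mulg_lambda x y : (x * y)%g = x + lambda x y.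
Proof. by rewrite addrC subrK. Qed.

Lemma lambdaD x : {morph lambda x : y z / y + z}.
Proof. by move=> y z; rewrite /lambda brace_mulDr addrA. Qed.

Lemma lambda1 y : lambda 1%g y = y.
Proof. by rewrite /lambda mul1g brace_one subr0. Qed.

Lemma lambdaM x y z : lambda (x * y)%g z = lambda x (lambda y z).
Proof.
apply: (addrI (x * y)%g); rewrite -mulg_lambda -mulgA (mulg_lambda y z).
by rewrite brace_mulDr -addrA [- x + _]addrC.
Qed.

End LeftBrace.

Lemma brace_isog_trans (A B C : leftBraceType) :
  brace_isog A B -> brace_isog B C -> brace_isog A C.
Proof.
move=> [f [bij_f fD fM]] [g [bij_g gD gM]]; exists (g \o f).
split=> [|x y|x y] /=.
- exact: bij_comp.
- by rewrite fD gD.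
- by rewrite fM gM.
Qed.

Lemma sdbrace_mulE p (B : finLeftBraceType)
    (t : {morphism [set: B] >-> {unit 'F_p}}) (x y : sdbrace t) :
  (x * y)%g = (x.1 + val (t x.2) * y.1, (x.2 * y.2)%g) :> sdbrace t.
Proof. by []. Qed.

(** Coprimality makes f diagonal; comparing f on the product (0, b) (1, 0)
with the product of the images shows that its component g on the complements
intertwines the actions, an additive automorphism of Z_p being multiplication
by a unit. *)
Lemma sdbrace_isog p (B1 B2 : finLeftBraceType)
    (t1 : {morphism [set: B1] >-> {unit 'F_p}})
    (t2 : {morphism [set: B2] >-> {unit 'F_p}}) :
    prime p -> #|B1| = #|B2| -> coprime p #|B1| ->
  forall f : sdbrace t1 -> sdbrace t2,
    bijective f -> {morph f : x y / x + y} -> {morph f : x y / (x * y)%g} ->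
  exists g : B1 -> B2, [/\ bijective g, {morph g : x y / x + y},
    {morph g : x y / (x * y)%g}, forall b, t2 (g b) = t1 b
    & forall b, f (0, b) = (0, g b)].
Proof.
move=> p_pr oB co1 f [f' fK f'K] fD fM.
have f'D: {morph f' : x y / x + y}.
  by move=> x y; apply: (can_inj fK); rewrite fD !f'K.
have n_gt0: (0 < #|B1|)%N by apply/card_gt0P; exists 0.
have B2n (y : B2) : y *+ #|B1| = 0 by rewrite oB mulrn_card.
have p_gt0 := prime_gt0 p_pr.
have Fpp (a : 'F_p) : a *+ p = 0 by apply: mulrn_Fp.
pose g b := (f (0, b)).2; pose g' b := (f' (0, b)).2.
have fgE a b : f (a, b) = ((f (a, 0)).1, g b).
  exact: (coprime_additive_diag p_gt0 n_gt0 co1 Fpp Fpp (@mulrn_card B1) B2n fD).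
have fgE' a b : f' (a, b) = ((f' (a, 0)).1, g' b).
  exact: (coprime_additive_diag p_gt0 n_gt0 co1 Fpp Fpp B2n (@mulrn_card B1) f'D).
have fE b : f (0, b) = (0, g b) by rewrite fgE (morph_add0 fD).
have f'E b : f' (0, b) = (0, g' b) by rewrite fgE' (morph_add0 f'D).
exists g; split=> [|x y|x y|b|//].
- by exists g' => b; rewrite /g /g' -?fE -?f'E ?fK ?f'K.
- by rewrite /g -[RHS]/(_ + _).2 -fD; congr (f (_, _)).2; rewrite addr0.
- rewrite /g -[RHS]/((_ : sdbrace t2) * _)%g.2 -fM; congr (f (_, _)).2.
  by rewrite /= mulr0 addr0.
pose al a := (f (a, 0)).1.
have alD: {morph al : x y / x + y}.
  by move=> x y; rewrite /al -[RHS]/(_ + _).1 -fD; congr (f (_, _)).1; rewrite addr0.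
have alZ := additive_ZpE alD.
have al1: al 1 != 0.
  apply: contra_neq (oner_neq0 'F_p) => al1.
  have f1: f (1, 0) = f (0, 0).
    by rewrite (fgE 1 0) (fgE 0 0) -/(al 1) -/(al 0) (alZ 0) al1 mul0r.
  by case: (can_inj fK f1).
have := congr1 fst (fM (0, b) (1, 0)).
rewrite !sdbrace_mulE /= !mulr1 add0r fgE /=.
rewrite (fE b) /= add0r -/(al _) -/(al 1) alZ mulrC => /(mulIf al1) tE.
by apply/esym/val_inj.
Qed.

Lemma sdbrace_ker_isog p (B1 B2 : finLeftBraceType)
    (t1 : {morphism [set: B1] >-> {unit 'F_p}})
    (t2 : {morphism [set: B2] >-> {unit 'F_p}}) :
    prime p -> #|B1| = #|B2| -> coprime p #|B1| ->
    brace_isog (sdbrace t1) (sdbrace t2) ->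
  exists g : B1 -> B2, (forall b, t2 (g b) = t1 b) /\ ('ker t1 \isog 'ker t2)%g.
Proof.
move=> p_pr oB co1 [f [bij_f fD fM]].
have [g [bij_g _ gM tg _]] := sdbrace_isog p_pr oB co1 bij_f fD fM.
exists g; split=> //.
have gM' : {in ('ker t1)%g &, {morph g : x y / (x * y)%g}} by move=> x y _ _.
apply/isogP; exists (Morphism gM').
  by apply/injmP=> x y _ _; apply: (bij_inj bij_g).
have [g' gK g'K] := bij_g.
apply/setP=> y; apply/morphimP/idP => [[x _ kx ->]|ky] /=.
  by rewrite !inE /= tg -(mker kx).
have kx: g' y \in ('ker t1)%g by rewrite !inE /= -tg g'K (mker ky).
by exists (g' y).
Qed.

(** * The Klein brace and the braces built on it *)

(** The only brace with additive group Z_4 and the Klein group as multiplicative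
group: c d = c + (-1)^c d. *)
Definition kleinBrace : Type := 'Z_4.
HB.instance Definition _ := Finite.copy kleinBrace 'Z_4.
HB.instance Definition _ := GRing.Zmodule.copy kleinBrace 'Z_4.

Definition klein_mul (x y : kleinBrace) : kleinBrace :=
  if odd (x : 'Z_4) then x - y else x + y.
Definition klein_inv (x : kleinBrace) : kleinBrace :=
  if odd (x : 'Z_4) then x else - x.

Fact klein_mulA : associative klein_mul.
Proof.
by elim/Z4_ind => //; elim/Z4_ind => //; elim/Z4_ind; apply/eqP.
Qed.

Fact klein_mul1 : left_id (0 : kleinBrace) klein_mul.
Proof. by elim/Z4_ind; apply/eqP. Qed.

Fact klein_mulV : left_inverse (0 : kleinBrace) klein_inv klein_mul.
Proof. by elim/Z4_ind; apply/eqP. Qed.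

HB.instance Definition _ :=
  Finite_isGroup.Build kleinBrace klein_mulA klein_mul1 klein_mulV.

Fact klein_mulDr (x y z : kleinBrace) :
  (x * (y + z)%R)%g = (x * y)%g - x + (x * z)%g.
Proof.
rewrite /mulg /= /klein_mul; case: ifP => _.
  by rewrite opprD !addrA addrNK.
by rewrite (addrAC x y) subrr add0r addrCA.
Qed.

HB.instance Definition _ := isLeftBrace.Build kleinBrace klein_mulDr.

(** The four sign characters of the Klein group, encoded by their values at 1
and 3 (true stands for the sign -1); the value at 2 follows from 1 * 3 = 2. *)
Definition klein_char (q : bool * bool) (x : kleinBrace) : bool :=
  nth false [:: false; q.1; q.1 (+) q.2; q.2] (x : 'Z_4).

Lemma klein_charM q : {morph klein_char q : x y / (x * y)%g >-> x (+) y}.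
Proof. by case: q => [[] []]; elim/Z4_ind; elim/Z4_ind; apply/eqP. Qed.

Definition unitN1 (p : nat) : {unit 'F_p} := FinRing.unit 'F_p (unitrN1 'F_p).

Section SignAction.
Variables (p : nat) (B : finLeftBraceType) (e : B -> bool).
Hypothesis eM : {morph e : x y / (x * y)%g >-> x (+) y}.

Definition sign_act (x : B) : {unit 'F_p} := (unitN1 p ^+ e x)%g.

Fact sign_actM : {in [set: B] &, {morph sign_act : x y / (x * y)%g}}.
Proof.
move=> x y _ _; rewrite /sign_act eM; case: (e x); case: (e y) => //=;
  rewrite ?mulg1 ?mul1g //; apply: val_inj => /=.
by rewrite mulrNN mulr1.
Qed.

Canonical sign_morphism := Morphism sign_actM.
End SignAction.

Definition brace12 (chi : bool * bool) : finLeftBraceType :=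
  sdbrace (sign_morphism 3 (klein_charM chi)).

Fact brace12_charM chi psi :
  {morph (fun x : brace12 chi => klein_char psi x.2)
     : x y / (x * y)%g >-> x (+) y}.
Proof. by move=> x y; rewrite /= klein_charM. Qed.

Definition brace12p (p : nat) (chi psi : bool * bool) : finLeftBraceType :=
  sdbrace (sign_morphism p (@brace12_charM chi psi)).

Definition swap (q : bool * bool) := (q.2, q.1).

Lemma klein_oppM : {morph (fun c : kleinBrace => - c) : x y / (x * y)%g}.
Proof. by elim/Z4_ind; elim/Z4_ind; apply/eqP. Qed.

Lemma klein_char_opp q c : klein_char q (- c) = klein_char (swap q) c.
Proof. by case: q => [[] []]; elim/Z4_ind: c. Qed.

Lemma brace12p_swap p chi psi :
  brace_isog (brace12p p chi psi) (brace12p p (swap chi) (swap psi)).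
Proof.
pose f (x : 'F_p * ('F_3 * kleinBrace)) := (x.1, (x.2.1, - x.2.2)).
exists f; split=> [|x y|x y].
- by exists f => [] [a [b c]]; rewrite /f /= opprK.
- by congr (_, (_, _)); apply: opprD.
congr (_, (_, _)); last exact: klein_oppM.
  by rewrite /= /sign_act klein_char_opp; case: (chi) (psi) => [? ?] [].
by rewrite /= /sign_act klein_char_opp; case: (chi) (psi) => [? ?] [].
Qed.

Lemma klein_charE q : q = (klein_char q 1, klein_char q (1 *+ 3)).
Proof. by case: q. Qed.

Lemma klein_sqr (c : kleinBrace) : (c * c = 1)%g.
Proof. by elim/Z4_ind: c; apply/eqP. Qed.

Lemma klein_comm (c d : kleinBrace) : (c * d = d * c)%g.
Proof. by elim/Z4_ind: c; elim/Z4_ind: d; apply/eqP. Qed.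

(** * Dihedral groups and their extensions *)

Section Dihedral.
Local Open Scope group_scope.

Lemma isog_dihedral (gT : finGroupType) (G : {group gT}) q x y :
    (1 < q)%N -> #|G| = q.*2 -> <[x]> <*> <[y]> = G ->
    x ^+ q = 1 -> y ^+ 2 = 1 -> x ^ y = x^-1 ->
  G \isog 'D_(q.*2).
Proof.
move=> q_gt1 oG defG xq y2 xy.
apply/(isoGrpP _ (Grp_dihedral q_gt1)); split.
  by rewrite oG card_dihedral.
by apply/existsP; exists (x, y); rewrite /= !xpair_eqE defG xq y2 xy !eqxx.
Qed.

(** If y were a power of x, it would commute with x, so that x would be its own
inverse; as x has order larger than 2, x and y generate more than <[x]>,
hence all of G. *)
Lemma isog_dihedral_elem (gT : finGroupType) (G : {group gT}) x y :
    (2 < #[x])%N -> #|G| = #[x].*2 -> x \in G -> y \in G ->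
    y ^+ 2 = 1 -> x * y * x = y ->
  G \isog 'D_(#[x].*2).
Proof.
move=> x_gt2 oG Gx Gy y2 xyx.
have xy: x ^ y = x^-1.
  by apply: (mulgI y); apply: (mulIg x); rewrite mulKVg xyx mulgKV.
apply: (@isog_dihedral _ _ _ x y) => //; try exact: expg_order.
  exact: ltnW.
have sJG: <[x]> <*> <[y]> \subset G by rewrite join_subG !cycle_subG Gx.
have [m oJ] := dvdnP (cardSg (joing_subl <[x]> <[y]>)).
apply/eqP; rewrite eqEcard sJG oG oJ -mul2n leq_mul2r.
apply/orP; right; rewrite ltnNge; apply: contraL x_gt2 => m_le1.
rewrite -leqNgt dvdn_leq // order_dvdn.
have /eqP def_x: <[x]> == <[x]> <*> <[y]>.
  rewrite eqEcard joing_subl oJ -{2}[#|<[x]>|]mul1n leq_mul2r m_le1 orbT //.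
have cxy: commute x y.
  apply: (centsP (cycle_abelian x)); rewrite ?cycle_id // def_x.
  by rewrite (subsetP (joing_subr _ _)) ?cycle_id.
have : x ^ y = x by rewrite conjgE cxy mulKg.
by rewrite xy => xV; rewrite expgS expg1 -{1}xV mulVg.
Qed.

(** Only the relations and the normal form of the elements are recorded: they
suffice to derive the properties of dihedral quotients below. *)
Lemma dihedral_gen q : (1 < q)%N -> exists x y : 'D_(q.*2),
  [/\ x ^+ q = 1, y ^+ 2 = 1, x ^ y = x^-1
    & forall z, exists i j, z = x ^+ i * y ^+ j].
Proof.
move=> q_gt1; have := isoGrp_hom (Grp_dihedral q_gt1).
case/existsP=> [[x y]] /=; rewrite !xpair_eqE.
case/and4P=> /eqP defG /eqP xq /eqP y2 /eqP xy.
exists x, y; split=> // z.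
have: z \in <[x]> <*> <[y]> by rewrite defG inE.
rewrite norm_joinEr; last first.
  by rewrite cycle_subG; apply/normP; rewrite -cycleJ xy cycleV.
by case/imset2P=> _ _ /cycleP[i ->] /cycleP[j ->] ->; exists i, j.
Qed.

Section DihedralQuotient.
Variables (gT : finGroupType) (pi : gT -> 'D_12) (p : nat).
Hypothesis piM : {morph pi : x y / x * y}.
Hypothesis pi_surj : forall d, exists x, pi x = d.
Hypothesis kerX : forall x, pi x = 1 -> x ^+ p = 1.

Let pi1 : pi 1 = 1.
Proof. by apply: (mulgI (pi 1)); rewrite -piM !mulg1. Qed.

Let piX n : {morph pi : x / x ^+ n}.
Proof. by move=> x; elim: n => [|n IHn]; rewrite ?pi1 // !expgS piM IHn. Qed.

Let dihedral_elem (d : 'D_12) : exists w y : 'D_12,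
  [/\ w ^+ 6 = 1, y ^+ 2 = 1, w ^ y = w^-1 & d = w \/ d = w * y].
Proof.
have [x [y [x6 y2 xy gen]]] := @dihedral_gen 6 isT.
have [i [j ->]] := gen d; exists (x ^+ i), y; split=> //.
- by rewrite -expgM mulnC expgM x6 expg1n.
- by rewrite conjXg xy expgVn.
rewrite -(odd_double_half j) expgD -(mul2n j./2) (expgM y) y2 expg1n mulg1.
by case: (odd j); [right | left]; rewrite ?expg1 ?expg0 ?mulg1.
Qed.

Let reflection_sqr (w y : 'D_12) :
  y ^+ 2 = 1 -> w ^ y = w^-1 -> (w * y) ^+ 2 = 1.
Proof. by move=> y2 wy; rewrite expgS expg1 {1}(conjgC w y) wy -mulgA mulKg. Qed.

(** In the dihedral group of order 12 no element has order 4, so z^2 lies in the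
kernel; its order then divides both 2 and the odd number p. *)
Lemma exp4_dihedral_quotient (z : gT) : odd p -> z ^+ 4 = 1 -> z ^+ 2 = 1.
Proof.
move=> p_odd z4; have [w [y [w6 y2 wy def_z]]] := dihedral_elem (pi z).
have pz2: pi z ^+ 2 = 1.
  case: def_z => def_z; last by rewrite def_z reflection_sqr.
  apply: (mulgI (pi z ^+ 4)).
  by rewrite -expgD def_z w6 -def_z -piX z4 pi1 mulg1.
have zp: (z ^+ 2) ^+ p = 1 by apply: kerX; rewrite piX.
rewrite -(odd_double_half p) p_odd expgS -muln2 mulnC (expgM _ 2) in zp.
by rewrite -(expgM z 2 2) z4 expg1n mulg1 in zp.
Qed.

(** In the dihedral group of order 12 an element of order 3 is a rotation, and
rotations of order 3 do not commute with reflections. *)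
Lemma central_dihedral_quotient (z : gT) :
  (forall x, commute x z) -> z ^+ 3 = 1 -> coprime p 3 -> z = 1.
Proof.
move=> cz z3 co_p3; have [w [y [w6 y2 wy def_z]]] := dihedral_elem (pi z).
have pz3: pi z ^+ 3 = 1 by rewrite -piX z3.
have pz1: pi z = 1.
  have pz2: pi z ^+ 2 = 1.
    case: def_z => def_z; last by rewrite def_z reflection_sqr.
    have [Y pY] := pi_surj y.
    have: commute w y by rewrite /commute -pY -def_z -!piM cz.
    move/commgP/conjg_fixP=> yw.
    by rewrite def_z expgS expg1 -{2}yw wy mulgV.
  by rewrite -pz3 expgS pz2 mulg1.
apply/eqP; rewrite -order_eq1 -dvdn1 -(eqP co_p3) dvdn_gcd !order_dvdn.
by rewrite kerX // z3 eqxx.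
Qed.

(** The kernel of pi has exponent p while the group of units of 'F_p has order
p - 1, so u factors through the dihedral group. There the rotation generator is
conjugate to its inverse and the reflection is an involution, so both have image
of square 1. *)
Lemma char_dihedral_quotient (u : gT -> 'F_p) z :
    prime p -> u 1 = 1%R -> {morph u : x y / x * y >-> (x * y)%R} ->
  (u z ^+ 2 = 1)%R.
Proof.
move=> p_pr u1 uM; have [x [y [x6 y2 xy gen]]] := @dihedral_gen 6 isT.
have uX n : {morph u : a / a ^+ n >-> (a ^+ n)%R}.
  by move=> a; elim: n => [|n IHn]; rewrite ?u1 // expgS uM IHn exprS.
have uker k : pi k = 1 -> u k = 1%R.
  by move/kerX=> kp; rewrite -[LHS]exp_Fp // -uX kp.
have uE a b : pi a = pi b -> u a = u b.
  move=> ab; rewrite -(mulgKV b a) uM uker ?mul1r //.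
  by rewrite piM ab -piM mulgV.
have [X pX] := pi_surj x; have [Y pY] := pi_surj y.
have uX2 : (u X ^+ 2 = 1)%R.
  have : u (X ^ Y * X) = 1%R.
    apply: uker; rewrite piM !piM pX pY.
    have ->: pi Y^-1 = y^-1.
      by apply: (mulgI (pi Y)); rewrite -piM !mulgV -?pY ?mulgV.
    by rewrite -/(x ^ y) xy mulVg.
  by rewrite !uM mulrCA -(uM Y^-1) mulVg u1 mulr1 expr2.
have uY2 : (u Y ^+ 2 = 1)%R by rewrite -uX uker // piX pY.
have [i [j def_z]] := gen (pi z).
rewrite (uE z (X ^+ i * Y ^+ j)); last by rewrite piM !piX pX pY.
by rewrite uM !uX exprMn -!exprM ![(_ * 2)%N]mulnC !exprM uX2 uY2 !expr1n mulr1.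
Qed.

End DihedralQuotient.
End Dihedral.

Lemma ZpD12_quotient p (B : finLeftBraceType) :
    prime p -> mult_group_ZpD12 p B ->
  exists pi : B -> 'D_12, [/\ {morph pi : x y / (x * y)%g},
    forall d, exists x, pi x = d & forall x, pi x = 1%g -> (x ^+ p = 1)%g].
Proof.
move=> p_pr [tau /isogP[f injf imf]].
have fM: {morph f : x y / (x * y)%g} by move=> x y; rewrite morphM ?inE.
exists (fun x => (pair_of_sd (f x)).1); split=> [x y|d|x fx1].
- by rewrite fM.
- have: sdpair2 ('U \o tau)%gact d \in (f @* setT)%g by rewrite imf inE.
  case/morphimP=> x _ _ def_x; exists x; rewrite -def_x.
  by rewrite -[pair_of_sd _]/(val _) val_insubd !inE.
have def_fx: f x = sdpair1 ('U \o tau)%gact (pair_of_sd (f x)).2.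
  rewrite [LHS]sdpairE fx1; set s := sdpair2 _ _.
  have ->: s = 1%g by apply: (morph1 (sdpair2_morphism ('U \o tau)%gact)).
  by rewrite mul1g.
apply/eqP; rewrite -(morph_injm_eq1 injf) ?inE // morphX ?inE // def_fx.
rewrite -(morphX (sdpair1_morphism ('U \o tau)%gact)) ?inE //.
by rewrite FinRing.zmodXgE mulrn_Fp // morph1.
Qed.

(** The product of [sdprod_by] comes from a right action and that of [sdbrace]
from a left one, so the actions correspond by inversion. *)
Lemma sdbrace_mult_ZpD12 p (B : finLeftBraceType)
    (t : {morphism [set: B] >-> {unit 'F_p}}) :
  ([set: B] \isog [set: 'D_12])%g -> mult_group_ZpD12 p (sdbrace t).
Proof.
rewrite isog_sym => /isogP[g injg img].
have gM : {morph g : x y / (x * y)%g} by move=> x y; rewrite morphM ?inE.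
have tM : {morph t : x y / (x * y)%g} by move=> x y; rewrite morphM ?inE.
pose tau0 d := (t (g d))^-1%g.
have tau0M : {in [set: 'D_12] &, {morph tau0 : x y / (x * y)%g}}.
  move=> x y _ _; rewrite /tau0 gM tM invgM; apply: val_inj => /=; exact: mulrC.
exists (Morphism tau0M); set S := [set: sdprod_by _].
pose F (u : sdprod_by ('U \o Morphism tau0M)%gact) : sdbrace t :=
  (val (t (g (pair_of_sd u).1)) * (pair_of_sd u).2, g (pair_of_sd u).1).
have FM : {in S &, {morph F : x y / (x * y)%g}}.
  move=> u u' _ _; rewrite sdbrace_mulE /F /= gM tM /=; congr (_, _).
  rewrite mulrDr mulrA; congr (_ + _); rewrite /tau0 /= -!mulrA; congr (_ * _).
  by rewrite mulrCA divff ?mulr1 // -unitfE; apply: valP.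
rewrite isog_sym; apply/isogP; exists (Morphism FM).
  apply/injmP=> u u' _ _ eqF; apply: val_inj => /=.
  have {}e2 : (pair_of_sd u).1 = (pair_of_sd u').1.
    by apply: (injmP injg); rewrite ?inE //; case: eqF.
  have /= e1 := congr1 fst eqF.
  rewrite (surjective_pairing (pair_of_sd u)).
  rewrite (surjective_pairing (pair_of_sd u')).
  by rewrite e2 in e1 *; rewrite (mulrI (valP (t _)) e1).
apply/setP=> x; rewrite inE; case: x => a b.
have: b \in (g @* setT)%g by rewrite img inE.
case/morphimP=> d _ _ def_b.
have Sd: (d, (val (t b))^-1 * a) \in setX (Morphism tau0M @*^-1 setT)%g setT.
  by rewrite !inE.
apply/morphimP; exists (SdPair _ Sd); rewrite ?inE //=.
by rewrite /F /= -def_b mulrA mulfV ?mul1r // -unitfE; apply: valP.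
Qed.

(** * Coordinates on a brace and their characters *)

Definition crt12 (c : 'Z_12) : ('F_3 * 'Z_4)%type := (inZp c, inZp c).

Lemma crt12D : {morph crt12 : c d / c + d}.
Proof.
by move=> c d; congr (_, _); apply: val_inj => /=; rewrite modn_dvdm // modnDm.
Qed.

Lemma crt12_bij : bijective crt12.
Proof.
apply: inj_card_bij; last by rewrite card_prod !card_ord.
move=> c d /(congr1 (fun x => (val x.1, val x.2))) /= [e3 e4]; apply: val_inj.
have: c = d %[mod 3 * 4].
  by apply/eqP; rewrite chinese_remainder // -e3 -e4 !eqxx.
by rewrite !modn_small // ltn_ord.
Qed.

Section Classification.
Variables (p : nat) (B : finLeftBraceType) (pi : B -> 'D_12).
Hypotheses (p_pr : prime p) (co_p12 : coprime p 12).
Hypothesis piM : {morph pi : x y / (x * y)%g}.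
Hypothesis pi_surj : forall d, exists x, pi x = d.
Hypothesis kerX : forall x, pi x = 1%g -> (x ^+ p = 1)%g.
Variables (h : B -> 'F_p * ('F_3 * 'Z_4)) (h' : 'F_p * ('F_3 * 'Z_4) -> B).
Hypotheses (hK : cancel h h') (h'K : cancel h' h).
Hypothesis hD : {morph h : x y / x + y}.

Let p_odd : odd p. Proof. exact: coprime12_odd. Qed.

Let co_p3 : coprime p 3.
Proof. by move: co_p12; rewrite (@coprimeMr p 4 3) => /andP[]. Qed.

Let h'D : {morph h' : x y / x + y}.
Proof. by move=> x y; apply: (can_inj hK); rewrite hD !h'K. Qed.

Let h1 : h 1%g = 0. Proof. by rewrite brace_one (morph_add0 hD). Qed.

Let L x t := h (lambda x (h' t)).

Let LD x : {morph L x : s t / s + t}.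
Proof. by move=> s t; rewrite /L h'D lambdaD hD. Qed.

Let hM x y : h (x * y)%g = h x + L x (h y).
Proof. by rewrite mulg_lambda hD /L hK. Qed.

Let LM x y t : L (x * y)%g t = L x (L y t).
Proof. by rewrite /L lambdaM hK. Qed.

Let u x : 'F_p := (L x (1, (0, 0))).1.
Let v x : 'F_3 := (L x (0, (1, 0))).2.1.
Let w x : 'Z_4 := (L x (0, (0, 1))).2.2.

Let LE x a b c : L x (a, (b, c)) = (u x * a, (v x * b, w x * c)).
Proof.
have T12 (t : 'F_3 * 'Z_4) : t *+ 12 = 0.
  by case: t => [] [[|[|[|//]]] ?] [[|[|[|[|//]]]] ?]; apply/eqP.
have Fp (a' : 'F_p) : a' *+ p = 0 by apply: mulrn_Fp.
have Z4 (a' : 'Z_4) : a' *+ 4 = 0 by case: a' => [[|[|[|[|//]]]] ?]; apply/eqP.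
have F3 (a' : 'F_3) : a' *+ 3 = 0 by apply: mulrn_Fp.
have p_gt0 := prime_gt0 p_pr.
pose L1 b := (L x (b, 0)).1; pose L2 t := (L x (0, t)).2.
have L1D : {morph L1 : s t / s + t}.
  by move=> s t; rewrite /L1 -[RHS]/(_ + _).1 -LD; congr (L _ (_, _)).1; rewrite addr0.
have L2D : {morph L2 : s t / s + t}.
  by move=> s t; rewrite /L2 -[RHS]/(_ + _).2 -LD; congr (L _ (_, _)).2; rewrite addr0.
rewrite (coprime_additive_diag p_gt0 _ co_p12 Fp Fp T12 T12 (@LD x)) //.
congr (_, _); first exact: additive_ZpE L1D _.
rewrite -/(L2 _) (@coprime_additive_diag _ _ _ _ 3 4 L2) //; congr (_, _).
  apply: (@additive_ZpE 3 (fun b => (L2 (b, 0)).1)) => s t.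
  by rewrite -[RHS]/(_ + _).1 -L2D; congr (L2 (_, _)).1; rewrite addr0.
apply: (@additive_ZpE 4 (fun b => (L2 (0, b)).2)) => s t.
by rewrite -[RHS]/(_ + _).2 -L2D; congr (L2 (_, _)).2; rewrite addr0.
Qed.

Let uM : {morph u : x y / (x * y)%g >-> x * y}.
Proof. by move=> x y; rewrite /u LM !LE !mulr1. Qed.

Let vM : {morph v : x y / (x * y)%g >-> x * y}.
Proof. by move=> x y; rewrite /v LM !LE !mulr1. Qed.

Let wM : {morph w : x y / (x * y)%g >-> x * y}.
Proof. by move=> x y; rewrite /w LM !LE !mulr1. Qed.

Let L1 t : L 1%g t = t. Proof. by rewrite /L lambda1 h'K. Qed.

Let u1 : u 1%g = 1. Proof. by rewrite /u L1. Qed.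
Let v1 : v 1%g = 1. Proof. by rewrite /v L1. Qed.
Let w1 : w 1%g = 1. Proof. by rewrite /w L1. Qed.

Let u2 x : u x ^+ 2 = 1.
Proof. exact: (char_dihedral_quotient piM pi_surj kerX). Qed.

Let v2 x : v x ^+ 2 = 1.
Proof. by apply: (@F3_sqr _ (v x^-1)%g); rewrite -vM mulgV. Qed.

Let w2 x : w x ^+ 2 = 1.
Proof. by apply: (@Z4_sqr _ (w x^-1)%g); rewrite -wM mulgV. Qed.

Let h_bij : bijective h. Proof. by exists h'. Qed.

(** The elements of odd additive order; they form a multiplicative group of odd
   order because the lambda maps are diagonal. *)
Let oddPart := h @^-1: setX setT (setX setT [set 0]).

Let oddPart_group : group_set oddPart.
Proof.
apply/group_setP; split=> [|x y]; first by rewrite !inE h1.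
rewrite !inE hM; case: (h x) (h y) => [a [b c]] [a' [b' c']] /=.
by rewrite LE => /eqP-> /eqP->; rewrite mulr0 addr0.
Qed.

Let odd_exp x : (h x).2.2 = 0 -> (x ^+ (p * 3) = 1)%g.
Proof.
move=> hx; have Mx: x \in Group oddPart_group by rewrite !inE hx eqxx.
rewrite -(expg_cardG Mx) /= (on_card_preimset (onW_bij _ h_bij)).
by rewrite !cardsX !cardsT cards1 muln1 !card_Fp.
Qed.

Let twoPart := h @^-1: setX [set 0] (setX [set 0] setT).

Let twoPart_group : group_set twoPart.
Proof.
apply/group_setP; split=> [|x y]; first by rewrite !inE h1 !eqxx.
rewrite !inE hM; case: (h x) (h y) => [a [b c]] [a' [b' c']] /=.
rewrite LE !andbT => /andP[/eqP-> /eqP->] /andP[/eqP-> /eqP->].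
by rewrite !mulr0 !addr0 !eqxx.
Qed.

Let two_sqr c : (h' (0, (0, c)) ^+ 2 = 1)%g.
Proof.
set x := h' _; apply: (exp4_dihedral_quotient piM kerX) => //.
have Cx: x \in Group twoPart_group by rewrite !inE h'K !eqxx.
rewrite -(expg_cardG Cx) /= (on_card_preimset (onW_bij _ h_bij)).
by rewrite !cardsX !cards1 !mul1n cardsT card_ord.
Qed.

(** A sign is its own odd powers, and the elements of oddPart have odd order. *)
Let odd_trivial (R : pzRingType) (e : B -> R) :
    e 1%g = 1 -> {morph e : x y / (x * y)%g >-> x * y} ->
    (forall x, e x ^+ 2 = 1) ->
  forall x, (h x).2.2 = 0 -> e x = 1.
Proof.
move=> e1 eM e2 x hx; rewrite -(@odd_exp_sqr1 _ (e x) (p * 3)) ?oddM ?p_odd //.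
suff eX n : e (x ^+ n)%g = e x ^+ n by rewrite -eX odd_exp.
by elim: n => [|n IHn]; rewrite // expgS eM IHn exprS.
Qed.

Let L_odd x t : (h x).2.2 = 0 -> L x t = t.
Proof.
case: t => [a [b c]] hx.
by rewrite LE (odd_trivial u1 uM u2) // (odd_trivial v1 vM v2) //
           (odd_trivial w1 wM w2) // !mul1r.
Qed.

(** The elements with zero coordinates in 'F_p and 'F_3: a multiplicative Sylow
   2-subgroup, on which u, v and w are determined. *)
Let k c := h' (0, (0, c)).

Let char_two (R : pzRingType) (e : B -> R) :
    e 1%g = 1 -> {morph e : x y / (x * y)%g >-> x * y} ->
    (forall x, e x ^+ 2 = 1) ->
  forall x, e x = e (k (h x).2.2).
Proof.
move=> e1 eM e2 x; case def_hx: (h x) => [a [b c]] /=.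
have ->: x = (h' (a, (b, 0)) * k c)%g.
  apply: (can_inj hK); rewrite hM h'K L_odd h'K // def_hx.
  by congr (_, (_, _)); rewrite /= ?addr0 ?add0r.
by rewrite eM (odd_trivial e1 eM e2) ?mul1r ?h'K.
Qed.

Let kM c d : (k c * k d)%g = k (c + w (k c) * d).
Proof.
apply: (can_inj hK); rewrite hM !h'K LE.
by congr (_, (_, _)); rewrite /= mulr0 addr0.
Qed.

Let k0 : k 0 = 1%g. Proof. by apply: (can_inj hK); rewrite h'K h1. Qed.

(** The square of k c is k (c + w (k c) * c), and it is 1 = k 0; for odd c this
   gives 1 + w (k c) = 0. *)
Let wk_odd (c : 'Z_4) : odd c -> w (k c) = -1.
Proof.
have := two_sqr c; rewrite -/(k c) expgS expg1 kM -k0.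
move/(can_inj h'K) => [] /eqP; move: (w (k c)) => e.
by elim/Z4_ind: c => //; elim/Z4_ind: e => // _ _; apply/eqP.
Qed.

Let k2 : k (1 *+ 2) = (k 1%R * k (1 *+ 3)%R)%g.
Proof. by rewrite kM wk_odd //; apply: (congr1 k); apply/eqP. Qed.

Let wk (c d : 'Z_4) : c + w (k c) * d = ((c : kleinBrace) * (d : kleinBrace))%g.
Proof.
rewrite /mulg /= /klein_mul; case: ifP => [odd_c | even_c].
  by rewrite wk_odd // mulN1r.
have ->: w (k c) = 1; last by rewrite mul1r.
move: even_c; elim/Z4_ind: c => // _; first by rewrite k0 w1.
by rewrite k2 wM !wk_odd // mulrNN mulr1.
Qed.

Let Lt x t : L x t = (u x * t.1, (v x * t.2.1, w x * t.2.2)).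
Proof. by case: t => [a [b c]]; rewrite LE. Qed.

(** The coordinate map h itself is the isomorphism: the product in coordinates
is governed by u, v and w, which are sign characters of the Z_4-coordinate. *)
Lemma brace_classification :
  exists2 chi, chi != (false, false)
    & exists psi, brace_isog B (brace12p p chi psi).
Proof.
pose sgn q (e : B -> 'F_q) := (e (k 1) != 1, e (k (1 *+ 3)) != 1).
have sgnE q (e : B -> 'F_q) : prime q -> e 1%g = 1 ->
    {morph e : x y / (x * y)%g >-> x * y} -> (forall x, e x ^+ 2 = 1) ->
    forall x, e x = val (sign_act q (klein_char (sgn q e)) (h x).2.2).
  move=> q_pr e1 eM e2 x; rewrite (char_two e1 eM e2).
  have signE b : val (unitN1 q ^+ (b : bool))%g = (-1) ^+ b by case: b.
  have eE y : e y = (-1) ^+ (e y != 1).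
    have /eqP := e2 y; rewrite sqrf_eq1 => /orP[]/eqP->; rewrite ?eqxx //.
    by case: eqP.
  rewrite /sign_act signE; elim/Z4_ind: (h x).2.2 => /=.
  - by rewrite k0 e1.
  - exact: eE.
  - by rewrite k2 eM eE [X in _ * X]eE signr_addb.
  - exact: eE.
exists (sgn 3 v).
  (* Otherwise (0, (1, 0)) would be a central element of order 3. *)
  apply/negP => /eqP chi1.
  have vk x : v x = 1 by rewrite (sgnE 3) // chi1; elim/Z4_ind: (h x).2.2.
  pose z := h' (0, (1, 0)).
  suffices: z = 1%g by rewrite -k0 => /(can_inj h'K).
  apply: (central_dihedral_quotient piM pi_surj kerX) => // [x|].
    apply: (can_inj hK); rewrite !hM (@L_odd z) /z ?h'K // Lt vk !mulr0 mulr1.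
    by rewrite addrC.
  rewrite !expgS expg0 mulg1; apply: (can_inj hK).
  rewrite !hM !(@L_odd z) /z ?h'K // h1.
  by congr (_, (_, _)); rewrite /= ?addr0 //; apply/eqP.
exists (sgn p u), h; split=> // x y.
rewrite hM Lt.
rewrite (sgnE p u) // (sgnE 3 v) // (char_two w1 wM w2).
by congr (_, (_, _)); apply: wk.
Qed.

End Classification.

Lemma classification p (B : finLeftBraceType) : prime p -> coprime p 12 ->
    additive_group_ZpxC12 p B -> mult_group_ZpD12 p B ->
  exists2 chi, chi != (false, false)
    & exists psi, brace_isog B (brace12p p chi psi).
Proof.
move=> p_pr co_p12 [f [[f' fK f'K] fD]].
move=> /(ZpD12_quotient p_pr)[pi [piM pi_surj kerX]].
have [g' gK g'K] := crt12_bij.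
pose h x := ((f x).1, crt12 (f x).2); pose h' t := f' (t.1, g' t.2).
apply: (@brace_classification p B pi p_pr co_p12 piM pi_surj kerX h h').
- by move=> x; rewrite /h /h' /= gK -surjective_pairing fK.
- by case=> a t; rewrite /h /h' f'K /= g'K.
- by move=> x y; rewrite /h fD /= crt12D.
Qed.

(** * Isomorphisms between the braces of the family *)

Lemma brace12p_additive p chi psi :
  additive_group_ZpxC12 p (brace12p p chi psi).
Proof.
have [g' gK g'K] := crt12_bij.
exists (fun x => (x.1, g' x.2)); split.
  by exists (fun x => (x.1, crt12 x.2)) => [] [a b] /=; rewrite ?gK ?g'K.
by move=> x y; congr (_, _); apply: (can_inj gK); rewrite crt12D !g'K.
Qed.

Section OddPrime.
Variable p : nat.
Hypotheses (p_pr : prime p) (p_odd : odd p).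

Lemma unitN1_neq1 : unitN1 p != 1%g.
Proof.
rewrite -val_eqE /= eq_sym -subr_eq0 opprK -[1 + 1]/(2%:R).
rewrite -(dvdn_pcharf (pchar_Fp p_pr)) dvdn_prime2 //.
by apply: contraTneq p_odd => ->.
Qed.

Lemma unitN1X_inj (b b' : bool) : (unitN1 p ^+ b = unitN1 p ^+ b')%g -> b = b'.
Proof.
by case: b b' => [] [] // /eqP; rewrite ?[1%g == _]eq_sym ?(negbTE unitN1_neq1).
Qed.

Lemma sign_act_eq1 (B : finLeftBraceType) (e : B -> bool) x :
  (sign_act p e x == 1%g) = ~~ e x.
Proof.
rewrite /sign_act; case: (e x); rewrite ?eqxx //.
by rewrite expg1 (negbTE unitN1_neq1).
Qed.

End OddPrime.

Lemma card_brace12 chi : #|brace12 chi| = 12.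
Proof. by rewrite card_prod !card_ord. Qed.

Lemma brace12p_isog p chi psi chi' psi' : prime p -> coprime p 12 ->
    brace_isog (brace12p p chi psi) (brace12p p chi' psi') ->
  (chi, psi) = (chi', psi') \/ (chi, psi) = (swap chi', swap psi').
Proof.
move=> p_pr co_p12 [f [bij_f fD fM]].
have [|||g [bij_g gD gM tg _]] := sdbrace_isog _ _ _ bij_f fD fM => //.
  by rewrite card_brace12.
have [|||k [bij_k kD kM tk gk]] := sdbrace_isog _ _ _ bij_g gD gM => //.
  by rewrite card_ord.
have chiE c : klein_char chi c = klein_char chi' (k c).
  by apply: (@unitN1X_inj 3) => //; apply: esym (tk c).
have psiE c : klein_char psi c = klein_char psi' (k c).
  have := tg (0, c); rewrite gk => e.
  by apply: (@unitN1X_inj p) => //; first exact: coprime12_odd; apply: esym e.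
have kE := additive_ZpE kD.
have: k 1 = 1 \/ k 1 = -1.
  have: k (1 *+ 2) != 0 by rewrite -(morph_add0 kD) (bij_eq bij_k).
  rewrite kE; elim/Z4_ind: (k 1) => // _; first by left.
  by right; apply/eqP.
case=> k1; [left | right].
  have kid c : k c = c by rewrite kE k1 mul1r.
  rewrite (klein_charE chi) (klein_charE psi).
  rewrite (klein_charE chi') (klein_charE psi').
  by rewrite !chiE !psiE !kid.
have kopp c : k c = - c by rewrite kE k1 mulN1r.
rewrite (klein_charE chi) (klein_charE psi).
rewrite (klein_charE (swap chi')) (klein_charE (swap psi')).
by rewrite !chiE !psiE !kopp !klein_char_opp.
Qed.

(** * Kernels *)

Lemma brace12_mulE chi (x y : brace12 chi) :
  (x * y)%g = (x.1 + (-1) ^+ klein_char chi x.2 * y.1, (x.2 * y.2)%g)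
    :> brace12 chi.
Proof.
rewrite sdbrace_mulE; congr (_ + _ * _, _).
by rewrite /= /sign_act; case: (klein_char _ _).
Qed.

Section Brace12.
Variable chi : bool * bool.

(** For k in the kernel of chi, rot k is a rotation, of order 3 or 6 according
to whether k is trivial, and the elements refl m with chi m = -1 invert it. *)
Definition rot (k : kleinBrace) : brace12 chi := (1, k).
Definition refl (m : kleinBrace) : brace12 chi := (0, m).

Lemma refl_sqr m : (refl m ^+ 2 = 1)%g.
Proof. by rewrite expgS expg1 brace12_mulE /= mulr0 addr0 klein_sqr. Qed.

Section Rotation.
Variable k : kleinBrace.
Hypothesis chi_k : ~~ klein_char chi k.

Lemma rot_sqr : (rot k ^+ 2)%g = (1 *+ 2, 1%g) :> brace12 chi.
Proof. by rewrite expgS expg1 brace12_mulE /= (negbTE chi_k) mul1r klein_sqr. Qed.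

Lemma rot_cube : (rot k ^+ 3)%g = (0, k) :> brace12 chi.
Proof.
rewrite expgS rot_sqr brace12_mulE /= (negbTE chi_k) mul1r mulg1.
by congr (_, _); apply/eqP.
Qed.

Lemma order_rot : #[rot k]%g = (if k == 1%g then 3 else 6).
Proof.
have x6: (rot k ^+ 6 = 1)%g.
  by rewrite (expgM _ 3 2) rot_cube -/(refl k) refl_sqr.
case: eqP => [k1 | /eqP k1].
  by apply: nt_prime_order; rewrite ?rot_cube ?k1.
have: (#[rot k] \in divisors 6)%g by rewrite -dvdn_divisors // order_dvdn x6.
rewrite (_ : divisors 6 = [:: 1; 2; 3; 6]%N) // !inE => /or4P[] /eqP // ox.
- by move/eqP: ox; rewrite order_eq1.
- by have := expg_order (rot k); rewrite ox rot_sqr.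
- have := expg_order (rot k); rewrite ox rot_cube => /(congr1 snd) /= k1'.
  by rewrite k1' eqxx in k1.
Qed.

Lemma rot_refl m : klein_char chi m -> (rot k * refl m * rot k = refl m)%g.
Proof.
move=> chi_m.
rewrite !brace12_mulE /= mulr0 addr0 klein_charM chi_m addbT chi_k.
by rewrite expr1 mulN1r subrr (klein_comm k) -mulgA klein_sqr mulg1.
Qed.

End Rotation.

Lemma klein_ker_pick : chi != (false, false) ->
  exists k : kleinBrace, (k != 1%g) && ~~ klein_char chi k.
Proof.
by case: chi => [[] []] // _;
  first [by exists 1 | by exists (1 *+ 2) | by exists (1 *+ 3)].
Qed.

(** A nontrivial k in the kernel of chi makes rot k of order 6, and any m
outside the kernel gives a reflection. *)
Lemma brace12_dihedral : chi != (false, false) ->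
  ([set: brace12 chi] \isog [set: 'D_12])%g.
Proof.
move=> chi_n1.
have [k /andP[k1 chi_k]] := klein_ker_pick chi_n1.
have [m chi_m] : exists m, klein_char chi m.
  case: chi chi_n1 => [[] []] //= _.
  - by exists 1.
  - by exists 1.
  - by exists (1 *+ 3).
have ox := order_rot chi_k; rewrite (negbTE k1) in ox.
have := @isog_dihedral_elem _ [group of [set: brace12 chi]] (rot k) (refl m).
by rewrite ox cardsT card_brace12; apply; rewrite ?inE ?refl_sqr ?rot_refl.
Qed.

Section Kernel.
Variables (p : nat) (psi : bool * bool).
Hypotheses (p_pr : prime p) (p_odd : odd p).

Definition brace12_char := sign_morphism p (@brace12_charM chi psi).

Lemma ker12E x : (x \in 'ker brace12_char)%g = ~~ klein_char psi x.2.
Proof. by rewrite !inE /= sign_act_eq1. Qed.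

Lemma card_ker12 :
  #|('ker brace12_char)%g| = if psi == (false, false) then 12 else 6.
Proof.
have ->: ('ker brace12_char)%g = setX [set: 'F_3] [set c | ~~ klein_char psi c].
  by apply/setP=> [[b c]]; rewrite ker12E !inE.
rewrite cardsX cardsT card_ord -sum1dep_card big_mkcond /=.
rewrite !big_ord_recl big_ord0 /=.
by case: psi => [[] []].
Qed.

Lemma ker12_cyclic :
  chi != (false, false) -> psi = chi -> cyclic ('ker brace12_char)%g.
Proof.
move=> chi_n1 psi_chi.
have [k /andP[k1 chi_k]] := klein_ker_pick chi_n1.
apply/cyclicP; exists (rot k); apply/eqP.
rewrite eq_sym eqEcard -orderE order_rot // (negbTE k1) cycle_subG ker12E.
by rewrite psi_chi chi_k card_ker12 psi_chi (negbTE chi_n1).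
Qed.

(** The kernel of psi has index at most 2, so it lies in the proper subgroup
ker chi only if the two kernels, and hence the two characters, coincide. *)
Lemma klein_pick : chi != (false, false) -> psi != chi ->
  exists m, klein_char chi m && ~~ klein_char psi m.
Proof.
by case: chi psi => [[] []] [[] []] // _ _;
  first [by exists 1 | by exists (1 *+ 2) | by exists (1 *+ 3)].
Qed.

Lemma ker12_nonabelian : chi != (false, false) -> psi != chi ->
  ~~ abelian ('ker brace12_char)%g.
Proof.
move=> chi_n1 psi_chi; have [m /andP[chi_m psi_m]] := klein_pick chi_n1 psi_chi.
apply/negP => /centsP abK.
have := abK (rot 1%g) _ (refl m) _; rewrite !ker12E /= => /(_ isT psi_m).
rewrite /commute !brace12_mulE /= chi_m => /(congr1 fst) /=.
by rewrite mulr0 mulr1 add0r => /eqP.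
Qed.

(** The kernel contains Z_3, and an element of ker psi outside ker chi inverts
it. *)
Lemma ker12_dihedral :
    chi != (false, false) -> psi != (false, false) -> psi != chi ->
  ('ker brace12_char \isog [set: 'D_6])%g.
Proof.
move=> chi_n1 psi_n1 psi_chi.
have [m /andP[chi_m psi_m]] := klein_pick chi_n1 psi_chi.
have ox := @order_rot 1%g isT; rewrite eqxx in ox.
have := @isog_dihedral_elem _ ('ker brace12_char)%G (rot 1%g) (refl m).
rewrite ox card_ker12 (negbTE psi_n1) !ker12E.
by apply; rewrite ?refl_sqr ?rot_refl.
Qed.

End Kernel.
End Brace12.

Section Kernels.
Variables (p : nat) (chi psi : bool * bool).
Hypotheses (p_pr : prime p) (co_p12 : coprime p 12).
Hypothesis chi_n1 : chi != (false, false).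
Let p_odd := coprime12_odd co_p12.
Let K := ('ker (brace12_char chi p psi))%G.

Let ker_transfer (B' : finLeftBraceType)
    (tau : {morphism [set: B'] >-> {unit 'F_p}}) :
    #|B'| = 12%N -> brace_isog (brace12p p chi psi) (sdbrace tau) ->
  (exists g : brace12 chi -> B', forall b, tau (g b) = brace12_char chi p psi b)
  /\ (K \isog 'ker tau)%g.
Proof.
move=> oB' iso; have oB : #|brace12 chi| = #|B'| by rewrite oB' card_brace12.
have co : coprime p #|brace12 chi| by rewrite card_brace12.
by have [g [tg iK]] := sdbrace_ker_isog p_pr oB co iso; split=> //; exists g.
Qed.

Let brace_isog_refl (B : leftBraceType) : brace_isog B B.
Proof. by exists id; split=> //; exists id. Qed.

Lemma direct_productE :
  is_direct_product p (brace12p p chi psi) <-> psi == (false, false).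
Proof.
split=> [[B' [tau [oB' tau1 iso]]] | /eqP psi1].
  have [[g tg] _] := ker_transfer oB' iso.
  have psi0 x : klein_char psi x = false.
    pose e (y : brace12 chi) := klein_char psi y.2.
    apply/negbTE; rewrite -(sign_act_eq1 p_pr p_odd e (refl chi x)).
    by apply/eqP; rewrite -[LHS](tg (refl chi x)) tau1.
  by rewrite (klein_charE psi) !psi0.
exists (brace12 chi), (brace12_char chi p psi); split=> //.
- exact: card_brace12.
- by move=> b; apply/eqP; rewrite /= sign_act_eq1 // psi1; elim/Z4_ind: b.2.
Qed.

Lemma cyclic6_kernelE : has_cyclic6_kernel p (brace12p p chi psi) <-> psi == chi.
Proof.
split=> [[B' [tau [oB' iso cK _]]] | /eqP psi_chi].
  have [_ iK] := ker_transfer oB' iso; apply: contraLR cK => psi_chi.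
  have nabK := ker12_nonabelian p_pr p_odd chi_n1 psi_chi.
  by rewrite -(isog_cyclic iK); apply: contra nabK; apply: cyclic_abelian.
exists (brace12 chi), (brace12_char chi p psi); split=> //.
- exact: card_brace12.
- exact: ker12_cyclic.
- by rewrite card_ker12 // psi_chi (negbTE chi_n1).
Qed.

Lemma dihedral6_kernelE : has_dihedral6_kernel p (brace12p p chi psi) <->
  (psi != (false, false)) && (psi != chi).
Proof.
split=> [[B' [tau [oB' iso D6]]] | /andP[psi_n1 psi_chi]].
  have [_ iK] := ker_transfer oB' iso; have iKD := isog_trans iK D6.
  apply/andP; split; apply/eqP => psiE.
    by have := card_isog iKD; rewrite card_ker12 // psiE (@card_dihedral 3).
  have /cyclic_abelian : cyclic K by apply: ker12_cyclic.
  rewrite (isog_abelian iKD).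
  (* The dihedral group of order 6 is not abelian, as it is isomorphic to the
     nonabelian kernel given by one particular pair of characters. *)
  have iD :
      ('ker (brace12_char (true, true) p (false, true)) \isog [set: 'D_6])%g.
    exact: ker12_dihedral.
  by rewrite -(isog_abelian iD); apply/negP; apply: ker12_nonabelian.
exists (brace12 chi), (brace12_char chi p psi); split=> //.
- exact: card_brace12.
- exact: ker12_dihedral.
Qed.

End Kernels.

(** * The seven classes *)

(** One pair (chi, psi) in each class modulo [swap]. The values at 1 and 3 are
equal for the nontrivial character fixed by c |-> - c, with kernel {0, 2}, and
(false, true) has kernel {0, 1}. The first two pairs give the full kernel, the
next two a cyclic one, the last three a dihedral one. *)
Definition params (i : 'I_7) : (bool * bool) * (bool * bool) :=
  nth ((true, true), (false, false))
    [:: ((true, true), (false, false)); ((false, true), (false, false));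
        ((true, true), (true, true)); ((false, true), (false, true));
        ((true, true), (false, true)); ((false, true), (true, true));
        ((false, true), (true, false))] i.

Lemma params_chi i : (params i).1 != (false, false).
Proof. by case: i => [[|[|[|[|[|[|[|//]]]]]]] ?]. Qed.

Lemma params_inj i j :
    params i = params j \/ params i = (swap (params j).1, swap (params j).2) ->
  i = j.
Proof.
by case: i j => [[|[|[|[|[|[|[|//]]]]]]] ?] [[|[|[|[|[|[|[|//]]]]]]] ?] [] //= _;
  apply: val_inj.
Qed.

Lemma params_surj chi psi : chi != (false, false) ->
  exists i, params i = (chi, psi) \/ params i = (swap chi, swap psi).
Proof.
case: chi psi => [[] []] [[] []] // _;
 first [by exists (@Ordinal 7 0 isT); auto | by exists (@Ordinal 7 1 isT); auto
  | by exists (@Ordinal 7 2 isT); auto | by exists (@Ordinal 7 3 isT); auto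
  | by exists (@Ordinal 7 4 isT); auto | by exists (@Ordinal 7 5 isT); auto
  | by exists (@Ordinal 7 6 isT); auto].
Qed.

Local Close Scope ring_scope.

Theorem proposition16 (p : nat) (p_prime : prime p) (p_ge7 : 7 <= p) :
  exists Bs : 'I_7 -> finLeftBraceType,
    [/\ forall i, additive_group_ZpxC12 p (Bs i) /\ mult_group_ZpD12 p (Bs i),
        forall i j, brace_isog (Bs i) (Bs j) -> i = j
      & forall B : finLeftBraceType,
          additive_group_ZpxC12 p B -> mult_group_ZpD12 p B ->
          exists i, brace_isog B (Bs i)]
    /\ [/\ forall i, is_direct_product p (Bs i) <-> i < 2,
           forall i, has_cyclic6_kernel p (Bs i) <-> 2 <= i < 4
         & forall i, has_dihedral6_kernel p (Bs i) <-> 4 <= i].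
Proof.
have co_p12 := coprime_p12 p_prime p_ge7.
exists (fun i => brace12p p (params i).1 (params i).2); split; split.
- move=> i; split; first exact: brace12p_additive.
  exact/sdbrace_mult_ZpD12/brace12_dihedral/params_chi.
- move=> i j /(brace12p_isog p_prime co_p12); rewrite -!surjective_pairing.
  exact: params_inj.
- move=> B addB multB.
  have [chi chi_n1 [psi isoB]] := classification p_prime co_p12 addB multB.
  have [i [] params_i] := params_surj psi chi_n1; exists i; rewrite params_i //.
  exact: brace_isog_trans isoB (brace12p_swap _ _ _).
- move=> i; apply: (iff_trans (direct_productE _ _ p_prime co_p12)).
  by case: i => [[|[|[|[|[|[|[|//]]]]]]] ?].
- move=> i; apply: (iff_trans (cyclic6_kernelE _ p_prime co_p12 (params_chi i))).
  by case: i => [[|[|[|[|[|[|[|//]]]]]]] ?].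
move=> i; apply: (iff_trans (dihedral6_kernelE _ p_prime co_p12 (params_chi i))).
by case: i => [[|[|[|[|[|[|[|//]]]]]]] ?].
Qed.
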